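(* Let $a,b,c,d$ be real numbers, let $g$ be a completely monotone function in $(x_0,\infty)$, and let $\alpha=\max(x_0,-d/c)$. If (1) $a>0$, $c=a$, $b\ge d$; or (2) $a>0$, $a>c>0$, $ad-bc\le 0$, then $$f(x)=\left(\frac{ax+b}{cx+d}\right)^{g(x)}$$ is logarithmically completely monotone, and completely monotone, in $(\alpha,\infty)$.
   Context: A function $f:I\to\mathbb{R}$ on an interval $I\subseteq\mathbb{R}$ is called completely monotone if it has derivatives of all orders and $(-1)^n f^{(n)}(x)\ge 0$ for all $n=0,1,2,\ldots$ and all $x\in I$. A positive function $f:I\to\mathbb{R}$ is called logarithmically completely monotone if it has derivatives of all orders and $(-1)^n(\log\circ f)^{(n)}(x)\ge 0$ for all $n=1,2,\ldots$ and all $x\in I$. *)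

(* Defs.v *)
From Stdlib Require Import Reals.
From Coquelicot Require Import Coquelicot.
Open Scope R_scope.

(* Functions on an interval are represented by total functions [R -> R].
   Only open intervals are considered, so that the derivatives at a point of
   the interval depend only on the values taken on the interval. *)
Definition in_open_interval (l r : Rbar) (x : R) : Prop :=
  Rbar_lt l x /\ Rbar_lt x r.

Definition smooth_on (l r : Rbar) (f : R -> R) : Prop :=
  forall (n : nat) (x : R), in_open_interval l r x -> ex_derive_n f n x.

Definition completely_monotone (l r : Rbar) (f : R -> R) : Prop :=
  smooth_on l r f /\
  forall (n : nat) (x : R),
    in_open_interval l r x -> 0 <= (-1) ^ n * Derive_n f n x.

(* Positivity and smoothness of [f] make [ln (f x)] smooth as well, so the
   total operator [Derive_n] gives its actual derivatives. *)
Definition log_completely_monotone (l r : Rbar) (f : R -> R) : Prop :=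
  (forall x : R, in_open_interval l r x -> 0 < f x) /\
  smooth_on l r f /\
  forall (n : nat) (x : R),
    (1 <= n)%nat -> in_open_interval l r x ->
    0 <= (-1) ^ n * Derive_n (fun t => ln (f t)) n x.

(* Main.v *)
(** Complete monotonicity passes to products because [-(u v)' = (-u') v + u (-v')],
    to exponentials because [-(exp u)' = (-u') exp u], and to [x |-> / (x + q)]
    because [-(/ (x + q))' = / (x + q) * / (x + q)]: in each case the nonnegativity
    of the [n + 1]-st signed derivative follows from that of lower order ones.
    Finally [ln f = g * h] with [h x = ln ((a x + b) / (c x + d)) >= 0] and
    [- h' x = (b / a - d / c) * / (x + b / a) * / (x + d / c)]. *)
Require Import Defs.
From Stdlib Require Import Reals Lra.
From Coquelicot Require Import Coquelicot.
Open Scope R_scope.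

(* Exhibiting the negated derivatives one at a time makes the closure properties
   plain inductions on [n], without the Leibniz or Faa di Bruno formulas. *)
Fixpoint cm_upto (l r : Rbar) (n : nat) (f : R -> R) : Prop :=
  (forall x, in_open_interval l r x -> 0 <= f x) /\
  match n with
  | O => True
  | S m => exists f' : R -> R,
      (forall x, in_open_interval l r x -> is_derive f x (- f' x)) /\
      cm_upto l r m f'
  end.

(** Openness of the interval is what allows identities valid only on it to be differentiated. *)
Lemma locally_in_open_interval l r x :
  in_open_interval l r x -> locally x (in_open_interval l r).
Proof.
  intros [Hl Hr]; apply filter_and.
  - exact (open_Rbar_gt l x Hl).
  - exact (open_Rbar_lt r x Hr).
Qed.

Lemma cm_upto_ge0 l r n f x :
  cm_upto l r n f -> in_open_interval l r x -> 0 <= f x.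
Proof. destruct n; intros [H _]; apply H. Qed.

Lemma cm_upto_ext l r n f g :
  (forall x, in_open_interval l r x -> f x = g x) ->
  cm_upto l r n f -> cm_upto l r n g.
Proof.
  intros E H; destruct n as [|n]; destruct H as [H0 H]; split; trivial;
    try (intros x Hx; rewrite <- E by exact Hx; now apply H0).
  destruct H as [f' [Hd Hf']]; exists f'; split; trivial.
  intros x Hx; apply is_derive_ext_loc with f; [|now apply Hd].
  apply filter_imp with (2 := locally_in_open_interval l r x Hx); exact E.
Qed.

(** The derivatives of a product and of an exponential still contain the undifferentiated functions,
    so their inductions need these one level lower. *)
Lemma cm_upto_pred l r n f : cm_upto l r (S n) f -> cm_upto l r n f.
Proof.
  revert f; induction n as [|n IH]; intros f [H0 [f' [Hd Hf']]]; split; trivial.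
  exists f'; split; trivial; now apply IH.
Qed.

Lemma cm_upto_const l r n k : 0 <= k -> cm_upto l r n (fun _ => k).
Proof.
  revert k; induction n as [|n IH]; intros k Hk; split; trivial.
  exists (fun _ => 0); split; [|apply IH; lra].
  intros x _; rewrite Ropp_0; apply (is_derive_const k x).
Qed.

Lemma cm_upto_plus l r n f g :
  cm_upto l r n f -> cm_upto l r n g -> cm_upto l r n (fun x => f x + g x).
Proof.
  revert f g; induction n as [|n IH]; intros f g [F0 F] [G0 G]; split; trivial;
    try (intros x Hx; apply Rplus_le_le_0_compat; auto).
  destruct F as [f' [Fd F]], G as [g' [Gd G]].
  exists (fun x => f' x + g' x); split; [|now apply IH].
  intros x Hx; rewrite Ropp_plus_distr.
  exact (is_derive_plus f g x _ _ (Fd x Hx) (Gd x Hx)).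
Qed.

Lemma cm_upto_mult l r n f g :
  cm_upto l r n f -> cm_upto l r n g -> cm_upto l r n (fun x => f x * g x).
Proof.
  revert f g; induction n as [|n IH]; intros f g F G; split; trivial;
    try (intros x Hx; apply Rmult_le_pos; eapply cm_upto_ge0; eauto).
  pose proof (cm_upto_pred _ _ _ _ F) as Fn; pose proof (cm_upto_pred _ _ _ _ G) as Gn.
  destruct F as [_ [f' [Fd F]]], G as [_ [g' [Gd G]]].
  exists (fun x => f' x * g x + f x * g' x); split.
  - intros x Hx.
    replace (- (f' x * g x + f x * g' x)) with (- f' x * g x + f x * - g' x) by ring.
    exact (is_derive_mult f g x _ _ (Fd x Hx) (Gd x Hx) Rmult_comm).
  - apply cm_upto_plus; now apply IH.
Qed.

Lemma cm_upto_exp l r n u :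
  cm_upto l r n u -> cm_upto l r n (fun x => exp (u x)).
Proof.
  revert u; induction n as [|n IH]; intros u U; split; trivial;
    try (intros x _; left; apply exp_pos).
  pose proof (cm_upto_pred _ _ _ _ U) as Un; destruct U as [_ [u' [Ud U]]].
  exists (fun x => u' x * exp (u x)); split.
  - intros x Hx; rewrite Ropp_mult_distr_l.
    exact (is_derive_comp exp u x _ _ (is_derive_exp (u x)) (Ud x Hx)).
  - apply cm_upto_mult; auto.
Qed.

Lemma cm_upto_inv_shift l r n q :
  (forall x, in_open_interval l r x -> 0 < x + q) ->
  cm_upto l r n (fun x => / (x + q)).
Proof.
  intros Hq; induction n as [|n IH]; split; trivial;
    try (intros x Hx; left; apply Rinv_0_lt_compat; auto).
  exists (fun x => / (x + q) * / (x + q)); split; [|now apply cm_upto_mult].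
  intros x Hx; specialize (Hq x Hx); auto_derive; [lra|field; lra].
Qed.

Lemma completely_monotone_cm_upto l r f n :
  completely_monotone l r f -> cm_upto l r n f.
Proof.
  intros [Hs Hp].
  (* Generalising to every signed derivative closes the induction: the witness for order [k] is the
     signed derivative of order [S k]. *)
  enough (H : forall k, cm_upto l r n (fun x => (-1) ^ k * Derive_n f k x)).
  { apply cm_upto_ext with (2 := H O); intros x _; simpl; ring. }
  induction n as [|n IH]; intros k; split; auto.
  exists (fun x => (-1) ^ S k * Derive_n f (S k) x); split; [|apply IH].
  intros x Hx.
  replace (- ((-1) ^ S k * Derive_n f (S k) x))
    with ((-1) ^ k * Derive_n f (S k) x) by (simpl; ring).
  apply (is_derive_scal (Derive_n f k)), Derive_correct, (Hs (S k) x Hx).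
Qed.

Lemma Derive_n_S_of_is_derive l r f f' n x :
  (forall y, in_open_interval l r y -> is_derive f y (- f' y)) ->
  in_open_interval l r x -> Derive_n f (S n) x = - Derive_n f' n x.
Proof.
  intros Hd Hx.
  (* [Derive_n] adds each new derivative on the outside; composing orders [n] and 1 moves one to the
     inside, where [f'] is known. *)
  rewrite <- Nat.add_1_r, <- (Derive_n_comp f n 1), <- Derive_n_opp.
  apply Derive_n_ext_loc.
  apply filter_imp with (2 := locally_in_open_interval l r x Hx).
  intros y Hy; apply is_derive_unique; auto.
Qed.

Lemma cm_upto_Derive_n l r n f x :
  cm_upto l r n f -> in_open_interval l r x ->
  ex_derive_n f n x /\ 0 <= (-1) ^ n * Derive_n f n x.
Proof.
  revert f x; induction n as [|n IH]; intros f x H Hx.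
  - split; [exact I|]; simpl; rewrite Rmult_1_l; now apply (cm_upto_ge0 l r 0).
  - destruct H as [_ [f' [Hd H]]]; destruct (IH f' x H Hx) as [He Hp]; split.
    (* At order one [He] is merely [True], so differentiability has to come from [Hd]. *)
    + destruct n as [|n]; [eexists; exact (Hd x Hx)|].
      apply (ex_derive_ext_loc (fun y => - Derive_n f' n y)).
      * apply filter_imp with (2 := locally_in_open_interval l r x Hx).
        intros y Hy; symmetry; now apply (Derive_n_S_of_is_derive l r).
      * exact (ex_derive_opp (Derive_n f' n) x He).
    + rewrite (Derive_n_S_of_is_derive l r f f') by assumption; simpl; lra.
Qed.

Lemma completely_monotone_of_cm_upto l r f :
  (forall n, cm_upto l r n f) -> completely_monotone l r f.
Proof. intros H; split; intros n x Hx; now apply (cm_upto_Derive_n l r n f x). Qed.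

Lemma cm_upto_ln_ratio l r n a b c d :
  0 < c -> c <= a -> d / c <= b / a ->
  (forall x, in_open_interval l r x ->
     0 < c * x + d /\ c * x + d <= a * x + b) ->
  cm_upto l r n (fun x => ln ((a * x + b) / (c * x + d))).
Proof.
  intros Hc Hca Hpq Hpos.
  assert (H0 : forall x, in_open_interval l r x ->
                 0 <= ln ((a * x + b) / (c * x + d))).
  { intros x Hx; destruct (Hpos x Hx) as [Hd Hle].
    rewrite <- ln_1; apply ln_le; [lra|].
    apply Rmult_le_reg_r with (c * x + d); [lra|].
    unfold Rdiv; rewrite Rmult_assoc, Rinv_l; lra. }
  destruct n as [|n]; split; trivial.
  (* The derivative of the logarithm is [/ (x + b / a) - / (x + d / c)]; over a common denominator
     its negative has the constant numerator [b / a - d / c], nonnegative by [Hpq]. *)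
  exists (fun x => (b / a - d / c) * (/ (x + b / a) * / (x + d / c))); split.
  - intros x Hx; destruct (Hpos x Hx) as [Hd Hle].
    auto_derive.
    + split; [lra|split; trivial]; apply Rdiv_lt_0_compat; lra.
    + field; repeat split; lra.
  - apply cm_upto_mult; [apply cm_upto_const; lra|].
    apply cm_upto_mult; apply cm_upto_inv_shift; intros x Hx;
      destruct (Hpos x Hx) as [Hd Hle].
    + replace (x + b / a) with ((a * x + b) / a) by (field; lra).
      apply Rdiv_lt_0_compat; lra.
    + replace (x + d / c) with ((c * x + d) / c) by (field; lra).
      apply Rdiv_lt_0_compat; lra.
Qed.

(* Stdlib reals with Coquelicot.  Under either hypothesis both [a * x + b] and
   [c * x + d] are positive to the right of [alpha], so that [Rpower] is the
   usual real power there. *)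
Theorem theorem2p15 (a b c d x0 : R) (g : R -> R)
    (hg : completely_monotone x0 p_infty g)
    (habcd : (a > 0 /\ c = a /\ b >= d) \/
             (a > 0 /\ (a > c /\ c > 0) /\ a * d - b * c <= 0)) :
  let alpha := Rmax x0 (- d / c) in
  let f := fun x : R => Rpower ((a * x + b) / (c * x + d)) (g x) in
  log_completely_monotone alpha p_infty f /\
  completely_monotone alpha p_infty f.
Proof.
  intros alpha f.
  (* Both alternatives are reduced to [0 < c <= a] and [a * d <= b * c]; when [c = a] the latter is
     [d <= b] multiplied by [a]. *)
  assert (Hc : 0 < c) by (destruct habcd as [H|H]; lra).
  assert (Hca : c <= a) by (destruct habcd as [H|H]; lra).
  assert (Hdet : a * d <= b * c).
  { destruct habcd as [[Ha [-> Hb]]|H]; [|lra].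
    rewrite (Rmult_comm b); apply Rmult_le_compat_l; lra. }
  assert (Hpos : forall x, in_open_interval alpha p_infty x ->
                   0 < c * x + d /\ c * x + d <= a * x + b).
  { intros x [Hx _]; simpl in Hx.
    assert (Hxd : - d / c < x) by (eapply Rle_lt_trans; [apply Rmax_r|exact Hx]).
    assert (Hd : 0 < c * x + d).
    { apply Rmult_lt_compat_l with (r := c) in Hxd; [|exact Hc].
      replace (c * (- d / c)) with (- d) in Hxd by (field; lra); lra. }
    split; [exact Hd|].
    (* c (ax + b - cx - d) = (a - c) (cx + d) + (bc - ad) *)
    apply Rmult_le_reg_l with c; [exact Hc|].
    pose proof (Rmult_le_pos (a - c) (c * x + d)); nra. }
  assert (Hpq : d / c <= b / a).
  { apply Rmult_le_reg_l with (a * c); [apply Rmult_lt_0_compat; lra|].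
    replace (a * c * (d / c)) with (a * d) by (field; lra).
    replace (a * c * (b / a)) with (b * c) by (field; lra); exact Hdet. }
  assert (Hg : completely_monotone alpha p_infty g).
  { assert (Hi : forall x, in_open_interval alpha p_infty x ->
                   in_open_interval x0 p_infty x).
    { intros x [Hx Hx']; split; [|exact Hx'].
      eapply Rle_lt_trans; [apply Rmax_l|exact Hx]. }
    destruct hg as [Hs Hp]; split; intros n x Hx; auto. }
  (* [Rpower y z] unfolds to [exp (z * ln y)], so [f x] is [exp (u x)] by computation. *)
  set (u := fun x => g x * ln ((a * x + b) / (c * x + d))).
  assert (Hu : forall n, cm_upto alpha p_infty n u).
  { intros n; apply cm_upto_mult.
    - now apply completely_monotone_cm_upto.
    - now apply cm_upto_ln_ratio. }
  assert (Hf : completely_monotone alpha p_infty f).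
  { apply completely_monotone_of_cm_upto; intros n; exact (cm_upto_exp _ _ n u (Hu n)). }
  split; [|exact Hf]; split; [intros x _; apply exp_pos|].
  split; [exact (proj1 Hf)|].
  intros n x _ Hx.
  (* The identity [ln (exp (u t)) = u t] holds at every real [t], so no restriction to the interval
     is needed here. *)
  rewrite (Derive_n_ext (fun t => ln (f t)) u) by (intros t; apply ln_exp).
  now apply (cm_upto_Derive_n alpha p_infty n u x).
Qed.
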